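(* Let $a,b,c,d,e,f\in\mathbb{R}$, and let $\mathcal{X}$ be the vector field on $\mathcal{H}$ given by $$\mathcal{X}(x,y,z)=\left(ax+by,\; cx+dy,\; ex+fy+(a+d)z\right).$$ Let $\beta_1,\beta_2,\gamma_1,\gamma_2\in\mathbb{R}$, let $H_1=\{(x,y,z)\in\mathcal{H}: z=0\}$, let $h:\mathcal{H}\to H_1$ be the homomorphism $$h(x,y,z)=(\beta_1 y+\gamma_1 z,\;\beta_2 y+\gamma_2 z,\;0),$$ let $K=\ker h$, and let $\pi_K:\mathcal{H}\to\mathcal{H}/K$ be the canonical projection. Put $$B=\begin{bmatrix}\beta_1&\gamma_1\\ \beta_2&\gamma_2\end{bmatrix}.$$ If $B$ is invertible, $a+d\neq 0$ and $e\neq 0$, then the pair $(\mathcal{X},\pi_K)$ is observable.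
   Context: $\mathcal{H}$ denotes the three-dimensional Heisenberg group, realized as $\mathbb{R}^3$ with the product $$(x,y,z)\cdot(w,s,t)=(x+w+yt,\;y+s,\;z+t),$$ with identity element $(0,0,0)$. The set $H_1=\{z=0\}$ is a subgroup of $\mathcal{H}$. The linear vector fields on $\mathcal{H}$ considered are those of the form $\mathcal{X}(x,y,z)=(ax+by,\,cx+dy,\,ex+fy+(a+d)z)$ with real constants $a,b,c,d,e,f$ (here $e$ is a real number, not the group identity). Let $\varphi_t$ denote the flow of $\mathcal{X}$, i.e. $t\mapsto\varphi_t(p)$ is the solution of $\dot p=\mathcal{X}(p)$ with initial condition $p$ at $t=0$. For a subgroup $K\subset\mathcal{H}$, $\pi_K:\mathcal{H}\to\mathcal{H}/K$ denotes the canonical projection $g\mapsto gK$, which is viewed as the output map. The pair $(\mathcal{X},\pi_K)$ is observable at $p_1\in\mathcal{H}$ if for every $p_2\in\mathcal{H}\setminus\{p_1\}$ there exists $t\geq 0$ such that $\pi_K(\varphi_t(p_1))\neq\pi_K(\varphi_t(p_2))$. It is observable if it is observable at every point of $\mathcal{H}$. *)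

(* Defs.v *)
From HB Require Import structures.
From mathcomp Require Import all_boot all_order all_algebra.
From mathcomp Require Import all_classical all_reals all_analysis.
From mathcomp Require Import ring.

Set Implicit Arguments.
Unset Strict Implicit.
Unset Printing Implicit Defensive.

Import Order.TTheory GRing.Theory Num.Theory.
Import numFieldNormedType.Exports.

Local Open Scope classical_set_scope.
Local Open Scope ring_scope.

(* The point (x, y, z) is the nested pair ((x, y), z). The alias keeps the
   Heisenberg law apart from the componentwise structures of R * R * R. *)
Definition heis (R : realType) : Type := (R * R * R)%type.

(* Topology, norm and vector space structure are those of R^3. *)
HB.instance Definition _ (R : realType) :=
  NormedModule.copy (heis R) (R * R * R)%type.

Section HeisenbergGroup.
Variable R : realType.
Implicit Types p q r : heis R.

Definition heis_mul p q : heis R :=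
  let: (x, y, z) := p in let: (w, s, t) := q in
  (x + w + y * t, y + s, z + t).

Definition heis_one : heis R := (0, 0, 0).

Definition heis_inv p : heis R :=
  let: (x, y, z) := p in (- x + y * z, - y, - z).

Lemma heis_mulA : associative heis_mul.
Proof.
by move=> [[x y] z] [[x' y'] z'] [[x'' y''] z''] /=; congr (_, _, _); ring.
Qed.

Lemma heis_mul1g : left_id heis_one heis_mul.
Proof. by move=> [[x y] z] /=; congr (_, _, _); ring. Qed.

Lemma heis_mulg1 : right_id heis_one heis_mul.
Proof. by move=> [[x y] z] /=; congr (_, _, _); ring. Qed.

Lemma heis_mulVg : left_inverse heis_one heis_inv heis_mul.
Proof.
by move=> [[x y] z] /=; rewrite /heis_one; congr (_, _, _); ring.
Qed.

Lemma heis_mulgV : right_inverse heis_one heis_inv heis_mul.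
Proof.
by move=> [[x y] z] /=; rewrite /heis_one; congr (_, _, _); ring.
Qed.

HB.instance Definition _ := isGroup.Build (heis R)
  heis_mulA heis_mul1g heis_mulg1 heis_mulVg heis_mulgV.

Definition in_H1 : pred (heis R) := fun p => p.2 == 0.

Lemma in_H1_group_closed : group_closed in_H1.
Proof.
split=> [|[[x y] z] [[x' y'] z']]; first exact/eqxx.
by rewrite !unfold_in /in_H1 /= => /eqP-> /eqP->; rewrite oppr0 addr0.
Qed.

Record H1 : Type := MkH1 { H1val : heis R; H1valP : in_H1 H1val }.
HB.instance Definition _ := [isSub for H1val].
HB.instance Definition _ := [Choice of H1 by <:].
HB.instance Definition _ :=
  SubChoice_isSubGroup.Build (heis R) in_H1 H1 in_H1_group_closed.

Section HomToH1.
Variables beta1 beta2 gamma1 gamma2 : R.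

Definition homH1 p : H1 :=
  let: (x, y, z) := p in
  @MkH1 (beta1 * y + gamma1 * z, beta2 * y + gamma2 * z, 0) (eqxx 0).

Lemma homH1_div : {morph homH1 : p q / (p / q)%g}.
Proof.
move=> [[x y] z] [[x' y'] z']; apply: val_inj.
by rewrite /=; congr (_, _, _); ring.
Qed.

HB.instance Definition _ := isGroupMorphism.Build (heis R) H1 homH1 homH1_div.

End HomToH1.

Definition linear_field (a b c d e f : R) p : heis R :=
  let: (x, y, z) := p in
  (a * x + b * y, c * x + d * y, e * x + f * y + (a + d) * z).

End HeisenbergGroup.

Definition hom_ker (G L : groupType) (h : {multiplicative G -> L}) : set G :=
  [set g | h g = 1%g].

(* The class of g in G/K is represented by the subset gK of G. *)
Definition coset_proj (G : groupType) (K : set G) (g : G) : set G :=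
  [set (g * k)%g | k in K].

Section Observability.
Variables (R : realType) (V : normedModType R).

Definition is_flow (X : V -> V) (phi : R -> V -> V) : Prop :=
  forall p : V, phi 0 p = p /\
    forall t : R, is_derive t (1 : R) (phi^~ p) (X (phi t p)).

Definition observable_at (Y : Type) (phi : R -> V -> V) (out : V -> Y)
    (p1 : V) : Prop :=
  forall p2 : V, p2 <> p1 ->
    exists2 t : R, 0 <= t & out (phi t p1) <> out (phi t p2).

Definition observable (Y : Type) (phi : R -> V -> V) (out : V -> Y) : Prop :=
  forall p1 : V, observable_at phi out p1.

End Observability.

(* Main.v *)
Require Import Defs.
From mathcomp Require Import all_boot all_order all_algebra.
From mathcomp Require Import all_classical all_reals all_analysis.

Import Order.TTheory GRing.Theory Num.Theory.
Import numFieldNormedType.Exports.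
Local Open Scope ring_scope.

(** Invertibility of B makes ker h the line of points (x, 0, 0), so the output
    of (x, y, z) amounts to the pair (y, z); only x is hidden. If two
    trajectories have the same output at every t >= 0, then their z-coordinates
    agree on the closed half-line, and so do the derivatives of these at t = 0,
    because a derivative is determined by the values on one side. The
    derivative of z along the field is e x + f y + (a + d) z, and y and z agree
    at t = 0; since e != 0, so does x, and the two initial points are equal.

    The argument works directly on the differential equation: [is_derive_snd]
    extracts the z-equation from the vector-valued one,
    [is_derive_unique_right] compares the two derivatives, and
    [coset_proj_ker_inj] with [homH1_inj_yz] read y and z off the output. *)

Lemma is_derive_snd (R : realType) (V W : normedModType R)
    (f : R -> (V * W)%type) (a v : R) (df : (V * W)%type) :
  is_derive a v f df -> is_derive a v (fun t => (f t).2) df.2.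
Proof.
case=> fv dfE; rewrite /derivable /derive in fv dfE.
have snd_cvg : (h^-1 *: (((fun t => (f t).2) \o shift a) (h *: v) - (f a).2)
    @[h --> 0^'] --> df.2)%classic.
  rewrite -dfE.
  apply: (cvg_comp _ (@snd V W) fv).
  exact: cvg_snd.
by split; [apply/cvg_ex; exists df.2|apply: cvg_lim].
Qed.

(** One-sided agreement is enough, since the limit of a difference quotient can
    be computed along h > 0. This is what allows an observation that starts at
    t = 0 to determine the velocity at t = 0 itself. *)
Lemma is_derive_unique_right (R : realType) (W : normedModType R)
    (f g : R -> W) (a : R) (df dg : W) :
  (forall t, a <= t -> f t = g t) ->
  is_derive a 1 f df -> is_derive a 1 g dg -> df = dg.
Proof.
move=> fg [fv <-] [gv <-]; rewrite /derivable in fv gv.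
rewrite /derive (cvg_at_rightE _ _ fv) (cvg_at_rightE _ _ gv).
congr (lim _); apply/seteqP.
by split; apply: near_eq_cvg; near=> h; rewrite /= !fg// lerDr scaler1 ltW.
Unshelve. all: by end_near. Qed.

Lemma coset_proj_ker_inj (G L : groupType) (h : {multiplicative G -> L})
    (g1 g2 : G) :
  coset_proj (hom_ker h) g1 = coset_proj (hom_ker h) g2 -> h g1 = h g2.
Proof.
move=> cosetE.
have h1 : h 1%g = 1%g.
  (* [multiplicative] only records products, so h 1 = 1 comes from
     idempotence and cancellation. *)
  by apply: (mulgI (h 1%g)); rewrite -gmulfM !mulg1.
have : coset_proj (hom_ker h) g1 g1 by exists 1%g; rewrite ?mulg1.
by rewrite cosetE => -[k hk <-]; rewrite gmulfM hk mulg1.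
Qed.

(** The first two coordinates of h(x, y, z) are the entries of B (y, z)^T. *)
Lemma homH1_inj_yz (R : realType) (beta1 beta2 gamma1 gamma2 : R)
    (p q : heis R) :
  (block_mx beta1%:M gamma1%:M beta2%:M gamma2%:M : 'M[R]_(1 + 1))
    \in unitmx ->
  homH1 beta1 beta2 gamma1 gamma2 p = homH1 beta1 beta2 gamma1 gamma2 q ->
  p.1.2 = q.1.2 /\ p.2 = q.2.
Proof.
case: p q => [[x y] z] [[x' y'] z'] Bu /(congr1 (@H1val R)) /= [hy hz].
set B := block_mx _ _ _ _ in Bu.
have BE u v : B *m col_mx u%:M v%:M =
    col_mx (beta1 * u + gamma1 * v)%:M (beta2 * u + gamma2 * v)%:M
    :> 'M[R]_(1 + 1, 1).
  by rewrite mul_block_col -!scalar_mxM -!raddfD.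
(* On 1 x 1 blocks the trace reads off the single entry. *)
have /eq_col_mx[/(congr1 mxtrace) + /(congr1 mxtrace)] :
    col_mx y%:M z%:M = col_mx y'%:M z'%:M :> 'M[R]_(1 + 1, 1).
  by rewrite -[LHS](mulKmx Bu) -[RHS](mulKmx Bu) !BE hy hz.
by rewrite !mxtrace_scalar !mulr1n.
Qed.

Theorem proposition3p3 (R : realType) (a b c d e f : R)
    (beta1 beta2 gamma1 gamma2 : R)
    (phi : R -> heis R -> heis R)
    (phi_flow : is_flow (linear_field a b c d e f) phi) :
  let h := homH1 beta1 beta2 gamma1 gamma2 in
  let K := hom_ker h in
  let B : 'M[R]_(1 + 1) :=
    block_mx beta1%:M gamma1%:M beta2%:M gamma2%:M in
  B \in unitmx -> a + d != 0 -> e != 0 ->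
  observable phi (coset_proj K).
Proof.
move=> h K B Bu _ e0 p1 p2 p12; apply: contrapT => same_out.
have yzE t : 0 <= t ->
    (phi t p1).1.2 = (phi t p2).1.2 /\ (phi t p1).2 = (phi t p2).2.
  move=> t0; have := @homH1_inj_yz _ _ _ _ _ (phi t p1) (phi t p2) Bu; apply.
  apply: coset_proj_ker_inj.
  by apply: contrapT => neq_out; apply: same_out; exists t.
have [[phi01 dphi1] [phi02 dphi2]] := (phi_flow p1, phi_flow p2).
have zdotE : (linear_field a b c d e f p1).2 = (linear_field a b c d e f p2).2.
  rewrite -[in LHS]phi01 -[in RHS]phi02.
  apply: (@is_derive_unique_right R R (fun t => (phi t p1).2)
    (fun t => (phi t p2).2) 0).
  - by move=> t /yzE[].
  - exact: is_derive_snd (dphi1 0).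
  - exact: is_derive_snd (dphi2 0).
have := yzE 0 (lexx 0); rewrite phi01 phi02.
case: p1 p2 p12 zdotE {yzE same_out phi01 phi02 dphi1 dphi2} =>
  [[x y] z] [[x' y'] z'] p12 /= + [yy' zz'].
rewrite yy' zz' => /addIr/addIr/(mulfI e0) xx'.
by apply: p12; rewrite xx' yy' zz'.
Qed.
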